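(* Let $(D,\mathfrak S)$ be a crude linear series of rank $r$ on a metric graph $\Gamma$. Let $G=(V,E)$ be a model of $\Gamma$ such that $D$ is supported on $V$, and let $e=uv$ be an oriented edge of $G$. For each point $x$ on $e$ other than its head $v$, let $\nu$ denote the unit tangent vector at $x$ pointing along $e$ in the direction of its orientation, and let $s_0^\nu(x)<\dots<s_r^\nu(x)$ be the elements of the set $S^\nu$ given by $\mathfrak S$ for the tangent vector $\nu$ at $x$. Then the vector-valued function $x\mapsto(s_0^\nu(x),\dots,s_r^\nu(x))$ is coordinatewise non-increasing along $e$: for every such $x$ and every sufficiently small $\varepsilon>0$, denoting by $y=x+\varepsilon\nu$ the point at distance $\varepsilon$ from $x$ in the direction $\nu$, one has $$s_j^\nu(y)\le s_j^\nu(x)\qquad\text{for every } j=0,1,\dots,r,$$ and consequently $s_j^\nu(y)\le s_j^\nu(x)$ whenever $x$ precedes $y$ on $e$.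
   Context: Metric graphs. A metric graph $\Gamma$ is the metric realization of a pair $(G,\ell)$, where $G=(V,E)$ is a finite connected graph with at least one edge and $\ell\colon E\to\mathbb R_{>0}$: each edge $e$ is replaced by a closed interval of length $\ell(e)$, glued according to $G$, with the path metric. $G$ (with $\ell$) is called a model of $\Gamma$; a model is simple if it has no loops and no parallel edges. $\mathrm T_x(\Gamma)$ is the finite set of outgoing unit tangent vectors at $x$, and $d_x=|\mathrm T_x(\Gamma)|$. $\mathrm{Rat}(\Gamma)$ is the set of continuous piecewise affine functions $f\colon\Gamma\to\mathbb R$ with integral slopes; $\mathrm{slope}_\nu(f)$ is the outgoing slope of $f$ along $\nu$. A divisor $D$ is a finite formal integer combination of points of $\Gamma$, $D(x)$ is its coefficient at $x$, $D\ge 0$ (effective) means all coefficients are $\geq 0$. $\mathrm{div}(f)=\sum_x \mathrm{ord}_x(f)(x)$ with $\mathrm{ord}_x(f)=-\sum_{\nu\in \mathrm T_x(\Gamma)}\mathrm{slope}_\nu(f)$. Hypercube rank functions. Put $[r]=\{0,\dots,r\}$. The hypercube $[r]^\delta$ ($\delta\geq 1$) carries the coordinatewise order $\preceq$ and coordinatewise max $\vee$ and min $\wedge$; $\underline e_i$ is the $i$-th unit vector. A rank function is a map $\rho\colon[r]^\delta\to\mathbb Z$ such that: (1) $\rho(t\,\underline e_i)=r-t$ for all $i$ and $t\in[r]$; (2) $\underline a\preceq\underline b$ implies $\rho(\underline b)\le\rho(\underline a)$; (3) $\rho(\underline a)+\rho(\underline b)\le\rho(\underline a\vee\underline b)+\rho(\underline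 a\wedge\underline b)$; (4) $\rho$ takes values in $\{-1,0,\dots,r\}$. A jump of $\rho$ is a point $\underline a$ with $\rho(\underline a)\ge 0$ and $\rho(\underline a+\underline e_i)=\rho(\underline a)-1$ for every $i$ with $\underline a+\underline e_i\in[r]^\delta$. The standard rank function is $\rho(\underline a)=\max\{-1,r-a_1-\dots-a_\delta\}$. Slope structures. A slope structure $\mathfrak S$ of width $r$ on $\Gamma$ is the data, on some simple graph model $H=(V',E')$ of $\Gamma$, of: for every oriented edge $uv$, a set $S^{uv}$ of integers $s_0^{uv}<\dots<s_r^{uv}$ with $s_i^{uv}+s_{r-i}^{vu}=0$; for every $v\in V'$, a rank function $\rho_v$ on $[r]^{d_v}$, whose coordinates are indexed by the oriented edges with tail $v$ (equivalently by $\mathrm T_v(\Gamma)$). It is extended to all of $\Gamma$: for $\nu\in \mathrm T_x(\Gamma)$, $S^\nu=\{s_0^\nu<\dots<s_r^\nu\}$ is $S^{uv}$ for the oriented edge $uv$ of $H$ parallel to $\nu$; for $x\in\Gamma\setminus V'$, $\rho_x$ is the standard rank function on $[r]^2$. For $\underline a=(a_\nu)_\nu\in[r]^{\mathrm T_x(\Gamma)}$ put $s_{\underline a}=(s^\nu_{a_\nu})_\nu$, and let $S^x=\{s_{\underline a}:\underline a\text{ a jump of }\rho_x\}$. A function $f\in\mathrm{Rat}(\Gamma)$ is compatible with $\mathfrak S$ if for every $x\in\Gamma$, $\mathrm{slope}_\nu(f)\in S^\nu$ for all $\nu\in\mathrm T_x(\Gamma)$, and $\partial_x(f):=(\mathrm{slope}_\nu(f))_{\nu\in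 \mathrm T_x(\Gamma)}\in S^x$. If $\partial_x(f)=s_{\underline a}$, write $\rho_x(\partial_x(f)):=\rho_x(\underline a)$. $\mathrm{Rat}(D,\mathfrak S)$ is the set of $f\in\mathrm{Rat}(\Gamma)$ compatible with $\mathfrak S$ with $D+\mathrm{div}(f)\ge0$. A crude linear series of rank $r$ is a pair $(D,\mathfrak S)$ with $D$ a divisor and $\mathfrak S$ a slope structure of width $r$ on $\Gamma$ such that for every effective divisor $E$ of degree $r$ there is $f\in\mathrm{Rat}(D,\mathfrak S)$ with $\rho_x(\partial_x(f))\ge E(x)$ for all $x\in\Gamma$ and $D+\mathrm{div}(f)-E\ge0$. *)

(* Defs.v *)
From HB Require Import structures.
From mathcomp Require Import all_boot all_order all_algebra finmap.
From mathcomp Require Import all_classical all_reals all_analysis.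

Set Implicit Arguments.
Unset Strict Implicit.
Unset Printing Implicit Defensive.

Import Order.TTheory GRing.Theory Num.Theory.
Import numFieldNormedType.Exports.

Local Open Scope classical_set_scope.
Local Open Scope ring_scope.

(* Loops and parallel edges are allowed.  [src] and [tgt] fix a reference
   orientation of each edge; oriented edges are introduced as [oedge] below. *)
Record graph := Graph {
  vert : finType;
  edge : finType;
  src : edge -> vert;
  tgt : edge -> vert;
  edge_gt0 : (0 < #|edge|)%N;
  graph_connected : forall v w : vert,
    connect (fun a b => [exists e : edge,
      ((src e == a) && (tgt e == b)) || ((src e == b) && (tgt e == a))]) v w
}.

Definition simple_graph (G : graph) : Prop :=
  (forall e : edge G, src e <> tgt e) /\
  (forall e e' : edge G, [set src e; tgt e]%SET = [set src e'; tgt e']%SET ->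
     e = e').

(* [path_length len ept x y L]: [L] is the length of some path from [x] to [y]
   that is a concatenation of finitely many segments, each of them contained
   in one edge. *)
Inductive path_length (R : realType) (T : Type) (G : graph)
    (len : edge G -> R) (ept : edge G -> R -> T) : T -> T -> R -> Prop :=
| path_length_nil x : path_length len ept x x 0
| path_length_cons e s t y L : 0 <= s <= len e -> 0 <= t <= len e ->
    path_length len ept (ept e t) y L ->
    path_length len ept (ept e s) y (`|s - t| + L).

(* A model (G, len) of the metric space [Gamma]: the maps [ept e], restricted
   to [0, len e], identify [Gamma] with the disjoint union of these intervals
   glued at their end points according to G, and the distance is the path
   metric.  [ept e t] is irrelevant for t outside [0, len e]. *)
Record model (R : realType) (Gamma : metricType R) := Model {
  mgraph :> graph;
  len : edge mgraph -> R;
  vpt : vert mgraph -> Gamma;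
  ept : edge mgraph -> R -> Gamma;
  len_gt0 : forall e, 0 < len e;
  ept_src : forall e, ept e 0 = vpt (src e);
  ept_tgt : forall e, ept e (len e) = vpt (tgt e);
  vpt_inj : injective vpt;
  ept_neq_vpt : forall e t v, 0 < t < len e -> ept e t <> vpt v;
  ept_inj : forall e e' t t', 0 < t < len e -> 0 < t' < len e' ->
    ept e t = ept e' t' -> e = e' /\ t = t';
  ept_surj : forall x, exists e t, 0 <= t <= len e /\ ept e t = x;
  mdist_path : forall x y, mdist x y = inf [set L | path_length len ept x y L]
}.

Definition metric_graph (R : realType) (Gamma : metricType R) : Prop :=
  inhabited (model Gamma).

(* [(e, true)] is [e] oriented from [src e] to [tgt e]. *)
Definition oedge (G : graph) : finType := (edge G * bool)%type.

Definition orev (G : graph) (o : oedge G) : oedge G := (o.1, ~~ o.2).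

Section Tangent.
Variables (R : realType) (Gamma : metricType R).

(* A unit tangent vector at [x] is represented by a unit speed path [p] defined
   near 0 on the right, with [p 0 = x], up to equality of germs. *)
Definition same_germ (p q : R -> Gamma) : Prop :=
  p 0 = q 0 /\ \forall h \near 0^'+, p h = q h.

(* slope_nu(f), for nu the tangent vector represented by [p] *)
Definition slope (f : Gamma -> R) (p : R -> Gamma) : int :=
  xget 0 [set k : int | \forall h \near 0^'+, f (p h) = f (p 0) + k%:~R * h].

Variable M : model Gamma.

Definition olen (o : oedge M) : R := len o.1.

(* the point at distance [t] from the tail along the oriented edge [o] *)
Definition opt (o : oedge M) (t : R) : Gamma :=
  if o.2 then ept o.1 t else ept o.1 (len o.1 - t).

(* the tangent vector at [opt o t] pointing along [o]; here 0 <= t < olen o *)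
Definition edge_dir (o : oedge M) (t : R) : R -> Gamma :=
  fun h => opt o (t + h).

Definition is_pos (o : oedge M) (x : Gamma) (t : R) : Prop :=
  0 <= t < olen o /\ opt o t = x.

(* T_x(Gamma), read off the model: the unit tangent vectors at [x] are in
   bijection with the oriented edges passing through [x] at a point other than
   their head.  For [x] a vertex these are the oriented edges with tail [x];
   for [x] interior to an edge they are its two orientations. *)
Definition tangents (x : Gamma) : {set oedge M} :=
  [set o : oedge M | `[< exists t, is_pos o x t >]]%SET.

Definition tangent (x : Gamma) : finType := {o : oedge M | o \in tangents x}.

Definition tangent_dir (x : Gamma) (nu : tangent x) : R -> Gamma :=
  edge_dir (val nu) (xget 0 (is_pos (val nu) x)).

Definition bdry (f : Gamma -> R) (x : Gamma) : {ffun tangent x -> int} :=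
  [ffun nu => slope f (tangent_dir nu)].

(* ord_x(f), the coefficient of div(f) at [x]; its value does not depend on the
   model used to enumerate T_x(Gamma). *)
Definition ord (f : Gamma -> R) (x : Gamma) : int :=
  - \sum_(nu : tangent x) bdry f x nu.

End Tangent.

(* Piecewise affine with integral slopes: affine with integral slope on every
   edge of some model. *)
Definition is_rat (R : realType) (Gamma : metricType R) (f : Gamma -> R) :
    Prop :=
  continuous f /\
  exists M : model Gamma, forall e : edge M, exists k : int,
    forall t, 0 <= t <= len e -> f (ept e t) = f (ept e 0) + k%:~R * t.

Definition divisor (R : realType) (Gamma : metricType R) : Type :=
  {fsfun Gamma -> int with 0}.

Definition effective (R : realType) (Gamma : metricType R)
    (D : divisor Gamma) : Prop := forall x, 0 <= D x.

Definition degree (R : realType) (Gamma : metricType R)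
    (D : divisor Gamma) : int := \sum_(x <- finsupp D) D x.

Definition supported_on_vertices (R : realType) (Gamma : metricType R)
    (D : divisor Gamma) (G : model Gamma) : Prop :=
  forall x, D x != 0 -> exists v : vert G, vpt v = x.

Section Hypercube.
Variables (r : nat) (I : finType).

(* [r]^I *)
Definition cube := {ffun I -> 'I_r.+1}.

Implicit Types (a b : cube) (rho : cube -> int).

Definition cube_axis (t : 'I_r.+1) (i : I) : cube :=
  [ffun j => if j == i then t else ord0].

Definition cube_le a b : Prop := forall i, (a i <= b i)%N.
Definition cube_join a b : cube := [ffun i => Order.max (a i) (b i)].
Definition cube_meet a b : cube := [ffun i => Order.min (a i) (b i)].

Definition rank_function rho : Prop :=
  [/\ forall i (t : 'I_r.+1), rho (cube_axis t i) = r%:Z - (t : nat)%:Z,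
      forall a b, cube_le a b -> rho b <= rho a,
      forall a b, rho a + rho b <= rho (cube_join a b) + rho (cube_meet a b)
    & forall a, -1 <= rho a <= r%:Z].

(* b = a + e_i; there is no such [b] when [a + e_i] leaves the hypercube *)
Definition cube_succ a (i : I) b : Prop :=
  forall j, (b j : nat) = (a j + (j == i))%N.

Definition jump rho a : Prop :=
  0 <= rho a /\ forall i b, cube_succ a i b -> rho b = rho a - 1.

Definition standard_rank a : int :=
  Num.max (-1) (r%:Z - \sum_i (a i : nat)%:Z).

End Hypercube.

(* [ss_slope o i] is s_i^{uv} for the oriented edge [o = uv].  The rank
   functions are recorded already extended to all points of [Gamma]: only the
   values of [ss_rank] at vertices are data, by [ss_rank_std]. *)
Record slope_structure (R : realType) (Gamma : metricType R) (r : nat) :=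
    SlopeStructure {
  ss_model :> model Gamma;
  ss_simple : simple_graph ss_model;
  ss_slope : oedge ss_model -> 'I_r.+1 -> int;
  ss_slope_lt : forall o (i j : 'I_r.+1), (i < j)%N ->
    ss_slope o i < ss_slope o j;
  ss_slope_rev : forall o i, ss_slope o i + ss_slope (orev o) (rev_ord i) = 0;
  ss_rank : forall x : Gamma, cube r (tangent ss_model x) -> int;
  ss_rank_vert : forall v : vert ss_model, rank_function (@ss_rank (vpt v));
  ss_rank_std : forall x, (forall v : vert ss_model, vpt v <> x) ->
    forall a, @ss_rank x a = standard_rank a
}.

Arguments ss_rank {R Gamma r} s x a.

Section SlopeStructure.
Variables (R : realType) (Gamma : metricType R) (r : nat).
Variable S : slope_structure Gamma r.

(* s_j^nu, for nu the tangent vector represented by [p]: the slope attached to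
   the oriented edge of the model of [S] parallel to nu.  Such an edge exists
   and is unique as soon as [p] does represent a tangent vector. *)
Definition slope_elt (p : R -> Gamma) (j : 'I_r.+1) : int :=
  if [pick nu : tangent S (p 0) | `[< same_germ p (tangent_dir nu) >]]
    is Some nu then ss_slope (val nu) j else 0.

(* s_a *)
Definition slope_vec (x : Gamma) (a : cube r (tangent S x)) :
    {ffun tangent S x -> int} :=
  [ffun nu => ss_slope (val nu) (a nu)].

(* S^x *)
Definition slope_vecs (x : Gamma) : set {ffun tangent S x -> int} :=
  (@slope_vec x) @` [set a | jump (ss_rank S x) a].

Definition compatible (f : Gamma -> R) : Prop :=
  forall x : Gamma,
    (forall nu : tangent S x, range (ss_slope (val nu)) (bdry S f x nu)) /\
    slope_vecs (bdry S f x).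

(* rho_x(d_x f) >= n; the multi-index [a] is unique since the s_i increase *)
Definition rank_bdry_ge (f : Gamma -> R) (x : Gamma) (n : int) : Prop :=
  exists a : cube r (tangent S x),
    bdry S f x = slope_vec a /\ n <= ss_rank S x a.

Definition Rat (D : divisor Gamma) (f : Gamma -> R) : Prop :=
  [/\ is_rat f, compatible f & forall x, 0 <= D x + ord S f x].

Definition crude_linear_series (D : divisor Gamma) : Prop :=
  forall E : divisor Gamma, effective E -> degree E = r%:Z ->
  exists f : Gamma -> R,
    [/\ Rat D f,
        forall x, rank_bdry_ge f x (E x)
      & forall x, 0 <= D x + ord S f x - E x].

End SlopeStructure.

(* Main.v *)
Require Import Defs.
From mathcomp Require Import all_boot all_order all_algebra finmap.
From mathcomp Require Import all_classical all_reals all_analysis.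
From mathcomp Require Import lra zify.
Import Order.TTheory GRing.Theory Num.Theory.
Import numFieldNormedType.Exports.
Local Open Scope classical_set_scope.
Local Open Scope ring_scope.

(** Write [s_j] for the [j]-th slope along [e].  Just after a point the slopes
    are read off the same oriented edge of the model of [S], so they are locally
    constant to the right.  All the content is therefore in crossing a point [x]
    in the interior of [e]: if [o] and [o'] are the edges of the model of [S]
    carrying the forward and the backward tangent vector at [x], the slopes
    before [x] are the negatives of those along [o'] in reversed order, and
    the claim is the inequality [s_j^o + s_(r-j)^o' <= 0]
    (crude_slope_sum_le0).

    To prove it, put [j] points of the effective divisor [E] at an interior
    point of [o] and [r - j] points at an interior point of [o'], and take the
    function [f] provided by the crude linear series.  In the interior of an
    edge the rank function is standard, so that compatible functions are concave
    there (compatible_slope_nonincreasing), and rank at least [j] at the chosen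
    point of [o] forces the slope arriving there to be at least [s_j^o].  Hence
    the slope of [f] at [x] along [o] is at least [s_j^o], and likewise along
    [o'] it is at least [s_(r-j)^o'] (compatible_slope_ge).  As [D x = 0] and
    [x] has only these two tangent vectors, [D + div f >= 0] says that the sum
    of the two slopes is at most 0.

    Both monotonicity statements, for [s_j] along [e] and for the slope of [f]
    along an edge, are instances of a principle for functions of a real
    variable that are nonincreasing locally on the right and on the left
    (nonincreasing_of_local).

    Three models of the same space are involved: the one in which [e] is an
    edge, that of [S], and one on whose edges [f] is affine.  They are compared
    through the path metric alone (germ_match): near a point the space is a
    metric star whose branches are the oriented edges issuing from it, and a
    germ of a path in one model must stay on one branch in the other. *)

Local Notation edge_path M := (path_length (@len _ _ M) (@ept _ _ M)).

(** * Oriented edges and positions on them *)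

Section ModelGeometry.
Set Implicit Arguments.
Unset Strict Implicit.
Variables (R : realType) (Gamma : metricType R) (M : model Gamma).
Implicit Types (o : oedge M) (x y z : Gamma).

Lemma orevK (G : graph) (o : oedge G) : orev (orev o) = o.
Proof. by case: o => e b; rewrite /orev /= negbK. Qed.

Lemma orev_neq (G : graph) (o : oedge G) : orev o != o.
Proof. by case: o => e [|]; apply/eqP => -[]. Qed.

Lemma opt_orev o t : opt (orev o) t = opt o (olen o - t).
Proof. by case: o => e [|]; rewrite /opt /orev /olen //= subKr. Qed.

Lemma ept_end (e : edge M) s : s = 0 \/ s = len e ->
  exists v : vert M, ept e s = vpt v.
Proof. by case=> ->; eexists; [exact: ept_src|exact: ept_tgt]. Qed.

Lemma opt_end o t : t = 0 \/ t = olen o -> exists v : vert M, opt o t = vpt v.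
Proof.
by case: o => e [|] /= te; rewrite /opt /=; apply: ept_end; case: te => ->;
  rewrite /olen /=; [left|right|right; lra|left; lra].
Qed.

Lemma opt_neq_vpt o t (v : vert M) : 0 < t < olen o -> opt o t <> vpt v.
Proof.
by case: o => e [|]; rewrite /opt /olen /= => ht; apply: ept_neq_vpt => //; lra.
Qed.

Lemma ept_inj_int (e e' : edge M) s s' : 0 < s < len e -> 0 <= s' <= len e' ->
  ept e s = ept e' s' -> e = e' /\ s = s'.
Proof.
move=> hs hs' E; have [?|/negP ns] := boolP (0 < s' < len e').
  exact: ept_inj E.
have [|v Ev] := @ept_end e' s'; first by lra.
by have := @ept_neq_vpt _ _ M e s v hs; rewrite E Ev.
Qed.

Lemma opt_inj_int o o' t t' : 0 < t < olen o -> 0 <= t' <= olen o' ->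
  opt o t = opt o' t' ->
  (o = o' /\ t = t') \/ (o' = orev o /\ t' = olen o - t).
Proof.
case: o o' => [e b] [e' b']; rewrite /olen /= => ht ht' E.
have : e = e' /\
    (if b then t else len e - t) = (if b' then t' else len e' - t').
  by move: E; case: b; case: b'; rewrite /opt /=; apply: ept_inj_int; lra.
case=> ee; rewrite -ee => {E ht' }.
case: b; case: b'; rewrite /orev /= => E.
- by left.
- by right; split; [|lra].
- by right; split; [|lra].
- by left; split; [|lra].
Qed.

Lemma opt_int_edge o t (e : edge M) s : 0 < t < olen o -> 0 <= s <= len e ->
  opt o t = ept e s -> o.1 = e.
Proof.
case: o => e0 b ht hs /(@opt_inj_int _ (e, true) _ _ ht hs).
by case=> -[[-> _]].
Qed.

Lemma is_pos_uniq o x t t' : is_pos o x t -> is_pos o x t' -> t = t'.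
Proof.
move=> [ht <-] [ht' E].
have aux s s' : 0 < s < olen o -> 0 <= s' < olen o ->
    opt o s = opt o s' -> s = s'.
  move=> hs hs' /opt_inj_int; case=> //; first by lra.
    by case.
  by case=> H; have := orev_neq o; rewrite -H eqxx.
have [t0|t0] := ltrP 0 t; first by apply: aux => //; lra.
have [t0'|t0'] := ltrP 0 t'; first by apply/esym/aux => //; lra.
by lra.
Qed.

Lemma xget_is_pos o x t : is_pos o x t -> xget 0 (is_pos o x) = t.
Proof. by move=> H; apply: xget_subset1 H _ => a b; apply: is_pos_uniq. Qed.

(** Two tangent vectors with the same germ are carried by the same oriented
    edge: agreement at two nearby points excludes opposite orientations. *)
Lemma germ_oedge_inj o o' t t' (eta : R) : 0 < eta -> 0 <= t < olen o ->
  0 <= t' < olen o' ->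
  (forall h, 0 < h < eta -> opt o (t + h) = opt o' (t' + h)) -> o = o'.
Proof.
move=> eta0 ht ht' H.
pose m := Num.min eta (Num.min (olen o - t) (olen o' - t')).
have m0 : 0 < m by rewrite !lt_min; lra.
have [m1 m2 m3] : [/\ m <= eta, m <= olen o - t & m <= olen o' - t'].
  by rewrite /m; split; rewrite !ge_min lexx ?orbT.
have K h : 0 < h < m -> o = o' \/ t' + h = olen o - (t + h).
  move=> hh; have [|||[]|[_]] := @opt_inj_int o o' (t + h) (t' + h).
  - by lra.
  - by lra.
  - by apply: H; lra.
  - by left.
  - by right.
have [//|E2] := K (m / 2) ltac:(lra).
by have [//|E3] := K (m / 3) ltac:(lra); exfalso; lra.
Qed.

(** * The path metric *)

Lemma path_length_ge0 x y L : edge_path M x y L -> 0 <= L.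
Proof. by elim=> // *; rewrite addr_ge0. Qed.

Lemma path_length_exists x y : [set L | edge_path M x y L] !=set0.
Proof.
(* The infimum of the empty set is 0: points not joined by a path would be at
   distance 0, hence equal, hence joined by the trivial path. *)
apply/set0P/eqP => E.
have /mdist_positivity xy : mdist x y = 0 by rewrite (mdist_path M) E inf0.
have : [set L | edge_path M x y L] 0.
  by rewrite xy; exact: path_length_nil.
by rewrite E.
Qed.

Lemma mdist_ept_le (e : edge M) s t : 0 <= s <= len e -> 0 <= t <= len e ->
  mdist (ept e s) (ept e t) <= `|s - t|.
Proof.
move=> hs ht; rewrite (mdist_path M); apply: ge_inf.
  by exists 0 => L /path_length_ge0.
rewrite /= -(addr0 `|s - t|); apply: path_length_cons => //.
exact: path_length_nil.
Qed.

Lemma mdist_opt_le o s t : 0 <= s <= olen o -> 0 <= t <= olen o ->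
  mdist (opt o s) (opt o t) <= `|s - t|.
Proof.
case: o => e [|]; rewrite /opt /olen /= => hs ht; first exact: mdist_ept_le.
have -> : `|s - t| = `|(len e - s) - (len e - t)|.
  by rewrite distrC; congr (`|_|); lra.
by apply: mdist_ept_le; lra.
Qed.

(** A function that is 1-Lipschitz on every edge is 1-Lipschitz for the path
    metric. *)
Lemma lipschitz_edges (phi : Gamma -> R) :
  (forall (e : edge M) s t, 0 <= s <= len e -> 0 <= t <= len e ->
     `|phi (ept e s) - phi (ept e t)| <= `|s - t|) ->
  forall x y, `|phi x - phi y| <= mdist x y.
Proof.
move=> H x y; rewrite (mdist_path M); apply: lb_le_inf.
  exact: path_length_exists.
move=> L; elim=> [z|e s t z L' hs ht _ IH]; first by rewrite subrr normr0.
by rewrite (le_trans (ler_distD (phi (ept e t)) _ _)) // lerD // H.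
Qed.

(** The tent function of height [d / 2] on the segment of length [d] that
    starts at position [t] of the oriented edge [o]; it vanishes elsewhere,
    since the default value [u = 0] gives [min 0 d]. *)
Definition bump o t d y : R :=
  let u := xget 0 [set u | 0 < u < d /\ opt o (t + u) = y] in Num.min u (d - u).

Lemma bump_out o t d y : 0 < d -> (forall u, 0 < u < d -> opt o (t + u) <> y) ->
  bump o t d y = 0.
Proof.
move=> d0 H; rewrite /bump xgetPN; first by rewrite subr0 min_l // ltW.
by move=> u /= [/H].
Qed.

Lemma bump_opt o t d c : 0 < d -> 0 <= t -> t + d <= olen o ->
  0 <= c <= olen o ->
  bump o t d (opt o c) = Num.max 0 (Num.min (c - t) (d - (c - t))).
Proof.
move=> d0 t0 td hc.
have inj u : 0 < u < d -> opt o (t + u) = opt o c -> u = c - t.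
  move=> hu /opt_inj_int [||[_ ?]|[E _]]; [lra|lra|lra|].
  by have := orev_neq o; rewrite -E eqxx.
have [H|/negP H] := boolP (0 < c - t < d).
  rewrite /bump (@xget_subset1 _ _ _ (c - t)).
  - by rewrite max_r // le_min; lra.
  - by split=> //; rewrite addrC subrK.
  - by move=> u v [hu /(inj _ hu) ->] [hv /(inj _ hv) ->].
rewrite bump_out // => [|u hu /(inj _ hu) E]; last by apply: H; rewrite -E.
by rewrite max_l // ge_min; lra.
Qed.

Lemma bump_lipschitz o t d : 0 < d -> 0 <= t -> t + d <= olen o ->
  forall x y, `|bump o t d x - bump o t d y| <= mdist x y.
Proof.
move=> d0 t0 td; apply: lipschitz_edges => e s s' hs hs'.
have [oe|oe] := eqVneq o.1 e; last first.
  by rewrite !bump_out ?subrr ?normr0 // => u hu /opt_int_edge E;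
    case/eqP: oe; apply: E => //; lra.
have tent (u v : R) : `|Num.max 0 (Num.min u (d - u)) -
    Num.max 0 (Num.min v (d - v))| <= `|u - v|.
  rewrite ler_norml; have := ler_norm (u - v).
  have := ler_norm (v - u); rewrite distrC; move: `|u - v| => N; clear -R d0.
  rewrite /Num.max /Num.min.
  by case: (ltP u (d - u)); case: (ltP v (d - v)) => ? ?; do 2!case: ifP; lra.
move: oe td hs hs'; case: o => e1 [] /= <- td hs hs'.
  have E c : ept e1 c = opt (e1, true) c by [].
  rewrite !E !bump_opt //.
  have -> : `|s - s'| = `|(s - t) - (s' - t)| by congr (`|_|); lra.
  exact: tent.
have E c : ept e1 c = opt (e1, false) (len e1 - c) by rewrite /opt /= subKr.
rewrite !E !bump_opt //= ?/olen /=; try lra.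
have -> : `|s - s'| = `|(len e1 - s' - t) - (len e1 - s - t)|.
  by congr (`|_|); lra.
by rewrite [leRHS]distrC; exact: tent.
Qed.

(** Every oriented edge issuing from [x] has length at least [4 * d] left after
    [x].  The factor 4 leaves room for tents of length [2 * d] on two branches
    at [x], also when these are the two ends of a loop. *)
Definition pos_margin x (d : R) :=
  forall o t, is_pos o x t -> 4 * d <= olen o - t.

Lemma pos_margin_exists x : exists2 d : R, 0 < d & pos_margin x d.
Proof.
have H : \forall d \near 0^'+, pos_margin x d.
  apply: filter_forall => o.
  have [[t [ht E]]|no] := pselect (exists t, is_pos o x t); last first.
    by near=> d => t ht; case: no; exists t.
  have t0 : 0 < (olen o - t) / 4 by lra.
  near=> d => t' /(is_pos_uniq (conj ht E)) <-.
  suff : d < (olen o - t) / 4 by lra.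
  by near: d; apply: nbhs_right_lt.
by near (0 : R)^'+ => d; exists d => //; near: d.
Unshelve. all: by end_near. Qed.

Lemma bump_near o t d u : 0 < d -> 0 <= t -> t + 4 * d <= olen o ->
  0 <= u <= d ->
  bump o t (2 * d) (opt o (t + u)) = u.
Proof.
move=> d0 t0 td hu; rewrite bump_opt; try lra.
by rewrite /Num.max /Num.min; do 2!case: ifP; lra.
Qed.

(** On each branch of the star around [x], the height above [x] is an isometric
    coordinate. *)
Lemma mdist_star_same x d o t u u' : 0 < d -> pos_margin x d ->
  is_pos o x t -> 0 <= u <= d -> 0 <= u' <= d ->
  mdist (opt o (t + u)) (opt o (t + u')) = `|u - u'|.
Proof.
move=> d0 dx xt hu hu'; have td := dx _ _ xt; case: xt => ht _.
apply/eqP; rewrite eq_le; apply/andP; split.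
  have -> : `|u - u'| = `|(t + u) - (t + u')| by congr (`|_|); lra.
  by apply: mdist_opt_le; lra.
have := @bump_lipschitz o t (2 * d) _ _ _ (opt o (t + u)) (opt o (t + u')).
by rewrite !bump_near; try lra; apply; lra.
Qed.

(** Points on distinct branches at [x] are at distance at least either of their
    heights, hence more than the difference of the heights. *)
Lemma mdist_star_diff x d o o' t t' u u' : 0 < d -> pos_margin x d ->
  is_pos o x t -> is_pos o' x t' -> o != o' -> 0 <= u <= d -> 0 <= u' <= d ->
  u <= mdist (opt o (t + u)) (opt o' (t' + u')).
Proof.
move=> d0 dx xt xt' oo' hu hu'; have td := dx _ _ xt; have td' := dx _ _ xt'.
have [ht E] := xt; have [ht' E'] := xt'.
have := @bump_lipschitz o t (2 * d) _ _ _ (opt o (t + u)) (opt o' (t' + u')).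
rewrite bump_near; try lra.
(* the point on the branch [o'] is outside the tent over the branch [o] *)
rewrite bump_out; [|lra|]; last first.
  move=> v hv /opt_inj_int [||[oE]|[oE tE]]; try lra.
    by rewrite oE eqxx in oo'.
  have [t0|t0] := ltrP 0 t.
    have xt2 : is_pos o' x (olen o - t).
      rewrite oE; split; last by rewrite opt_orev subKr.
      by rewrite /olen /= in ht *; lra.
    by have := is_pos_uniq xt' xt2; lra.
  (* here [x] is the tail of both [o] and [o'], so the edge is a loop *)
  have t0' : ~ (0 < t').
    have [v0 Ev0] := @opt_end o t ltac:(lra).
    move=> t'0; apply: (@opt_neq_vpt o' t' v0); first by lra.
    by rewrite E' -E.
  by rewrite oE /olen /= in td' *; lra.
rewrite subr0 ger0_norm; last by lra.
by apply; lra.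
Qed.

(** A ball of small radius around [x] is covered by the edge segments that
    issue from [x]. *)
Lemma path_length_star x d y L : 0 < d -> pos_margin x d ->
  edge_path M x y L -> L < d ->
  exists o t u, [/\ is_pos o x t, 0 <= u <= L & y = opt o (t + u)].
Proof.
move=> d0 dx.
(* Invariant of the induction along the path: the current point lies on a
   common edge with [x], within the length travelled so far. *)
pose near_x (h : R) z := exists (e : edge M) (s0 s : R),
  [/\ 0 <= s0 <= len e, 0 <= s <= len e, ept e s0 = x, ept e s = z
    & `|s0 - s| <= h].
have step z L' : edge_path M z y L' ->
    forall h, near_x h z -> h + L' < d -> near_x (h + L') y.
  elim=> [w h|e s t w L1 hs ht p IH h [e1 [s0 [s1 [hs0 hs1 Ex Es h1]]]] hL].
    by rewrite addr0.
  have L10 := path_length_ge0 p.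
  rewrite addrA; apply: IH; last by lra.
  have [s10|s10] := eqVneq s1 s0.
    exists e, s, t; split=> //; first by rewrite -Es s10.
    by have := normr_ge0 (s0 - s1); lra.
  (* [x] is at distance at least [4 * d] from the ends of [e1] other than [x] *)
  have hs1' : 0 < s1 < len e1.
    have a0 : 0 < s0 -> 4 * d <= s0.
      move=> s00; have := @dx (e1, false) (len e1 - s0).
      by rewrite /is_pos /opt /olen /= subKr; apply; split=> //; lra.
    have a1 : s0 < len e1 -> 4 * d <= len e1 - s0.
      by move=> s00; apply: (@dx (e1, true)); split=> //; rewrite /olen /=; lra.
    have Lst := normr_ge0 (s - t).
    have : `|s0 - s1| < d by lra.
    rewrite ltr_norml => /andP[n1 n2].
    have [s0l|s0l] := ltP s0 (len e1); have [s00|s00] := ltP 0 s0.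
    - by have := a0 s00; have := a1 s0l; lra.
    - by have := a1 s0l; move/eqP: s10 => s10; lra.
    - by have := a0 s00; move/eqP: s10 => s10; lra.
    - by have := len_gt0 e1; lra.
  have [Ee Ess] := ept_inj_int hs1' hs Es.
  subst e1 s1; exists e, s0, t; split=> //.
  by rewrite (le_trans (ler_distD s _ _)) // lerD.
move=> p Ld; have L0 := path_length_ge0 p.
have [||e [s0 [s [hs0 hs Ex Es]]]] := step _ _ p 0; [|by lra|].
  by have [e [s [hs Es]]] := ept_surj M x; exists e, s, s; rewrite subrr normr0.
rewrite add0r => sL.
have [lt0s|le_s] := ltP s0 s.
  exists (e, true), s0, (s - s0); rewrite /is_pos /opt /olen /=; split.
  - by split=> //; lra.
  - by move: sL; rewrite ltr0_norm; lra.
  - by rewrite -Es; congr ept; lra.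
have [s00|s00] := ltP 0 s0.
  exists (e, false), (len e - s0), (s0 - s).
  rewrite /is_pos /opt /olen /= subKr; split=> //.
  - by split=> //; lra.
  - by move: sL; rewrite ger0_norm; lra.
  - by rewrite -Es; congr ept; lra.
have le0 := len_gt0 e; exists (e, true), s0, 0.
rewrite /is_pos /opt /olen /= addr0; split=> //.
- by split=> //; lra.
- by lra.
- by rewrite -Es; congr ept; lra.
Qed.

End ModelGeometry.

(** * Comparison of two models *)

Section Germs.
Set Implicit Arguments.
Unset Strict Implicit.
Variables (R : realType) (Gamma : metricType R).

Lemma near0P (P : R -> Prop) : (\forall h \near 0^'+, P h) <->
  exists2 eta : R, 0 < eta & forall h, 0 < h < eta -> P h.
Proof.
split=> [[eta /= eta0 H]|[eta eta0 H]].
  exists eta => // h /andP[h0 he]; apply: H => //=.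
  by rewrite sub0r normrN gtr0_norm.
near=> h; apply: H; apply/andP; split; near: h.
  exact: nbhs_right_gt.
exact: nbhs_right_lt.
Unshelve. all: by end_near. Qed.

(** The germs of unit speed paths issuing from a point are the same in all
    models.  They are recognised metrically: points at positive heights [h] and
    [h'] are at distance [`|h - h'|] if they are on the same germ, and at
    distance at least [max h h'] otherwise. *)
Lemma germ_match (M M' : model Gamma) (o : oedge M) t : 0 <= t < olen o ->
  exists (o' : oedge M') (t' : R), is_pos o' (opt o t) t' /\
  exists2 eta : R, 0 < eta & forall h, 0 <= h < eta ->
    [/\ t + h < olen o, t' + h < olen o' & opt o (t + h) = opt o' (t' + h)].
Proof.
move=> ht; set x := opt o t; have xt : is_pos o x t by [].
have [d d0 dx] := pos_margin_exists M x.
have [d' d'0 dx'] := pos_margin_exists M' x.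
pose eta := Num.min d d'.
have eta0 : 0 < eta by rewrite lt_min d0.
have [etad etad'] : eta <= d /\ eta <= d' by rewrite /eta !ge_min !lexx orbT.
have dist h h' : 0 <= h < eta -> 0 <= h' < eta ->
    mdist (opt o (t + h)) (opt o (t + h')) = `|h - h'|.
  by move=> hh hh'; apply: (mdist_star_same d0 dx xt); lra.
have branch h : 0 < h < eta -> exists (o' : oedge M') (t' : R),
    is_pos o' x t' /\ opt o (t + h) = opt o' (t' + h).
  move=> hh; have dxh : mdist x (opt o (t + h)) = h.
    have := dist 0 h; rewrite addr0 sub0r normrN gtr0_norm; last by lra.
    by apply; lra.
  have : inf [set L | edge_path M' x (opt o (t + h)) L] < d'.
    by rewrite -(mdist_path M') dxh; lra.
  move=> /inf_lt[|L /= p Ld]; first exact: path_length_exists.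
  have [ o' [t' [w [xt' hu E]]]] := path_length_star d'0 dx' p Ld.
  exists o', t'; split => //; rewrite E; congr (opt _ (_ + _)).
  have := @mdist_star_same _ _ _ _ _ _ _ 0 w d'0 dx' xt'.
  rewrite -E addr0; case: (xt') => _ ->.
  rewrite dxh sub0r normrN ger0_norm; last by lra.
  by move=> <- //; lra.
(* the branch of the second model that carries the germ is read off at height
   [eta / 2] *)
have [ o' [t' [xt' E']]] := branch (eta / 2) ltac:(lra).
exists o', t'; split=> //; exists eta => // h hh.
have td := dx _ _ xt; have td' := dx' _ _ xt'.
split; [lra|lra|].
have [->|h0] := eqVneq h 0; first by rewrite !addr0; case: xt' => _ ->.
have hpos : 0 < h by rewrite lt_neqAle eq_sym h0; lra.
have [ o2 [t2 [xt2 E2]]] := branch h ltac:(lra).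
have [oo|oo] := eqVneq o2 o'.
  by rewrite E2 oo; congr (opt _ (_ + _)); apply: (is_pos_uniq xt2); rewrite oo.
exfalso; have := dist h (eta / 2) ltac:(lra) ltac:(lra).
have /(_ h (eta / 2)) := mdist_star_diff d'0 dx' xt2 xt' oo.
have /(_ (eta / 2) h) := mdist_star_diff d'0 dx' xt' xt2 _.
rewrite eq_sym => /(_ oo); rewrite -E2 -E'.
rewrite [mdist (opt o (t + eta / 2)) _]metric_sym => H1 H2 H3.
have := H1 ltac:(lra) ltac:(lra); have := H2 ltac:(lra) ltac:(lra); rewrite H3.
by rewrite ler_normr => /orP[] ?; rewrite ler_normr => /orP[] ?; lra.
Qed.
End Germs.

(** * Monotonicity from local monotonicity *)

Section Local.
Set Implicit Arguments.
Unset Strict Implicit.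
Variables (R : realType).

(** If [F] exceeds [F t] somewhere after [t], let [c] be the infimum of the
    points where it does.  By the left condition [F c <= F t], and then by the
    right condition [F] does not exceed [F t] just after [c], a contradiction. *)
Lemma nonincreasing_of_local (F : R -> int) (a b : R) :
  (forall t, a <= t < b -> \forall h \near 0^'+, F (t + h) <= F t) ->
  (forall t, a < t < b -> \forall h \near 0^'+, F t <= F (t - h)) ->
  forall t t', a <= t -> t < t' -> t' < b -> F t' <= F t.
Proof.
move=> Fr Fl t t' at_ tt' t'b; rewrite leNgt; apply/negP => Ft'.
pose B := [set v : R | t < v <= t' /\ F t < F v].
have Bt' : B t' by split; rewrite ?tt' ?lexx.
have lB : lbound B t by move=> v [/andP[/ltW]].
have hB : has_inf B by split; [exists t'|exists t].
have tc : t <= inf B by apply: lb_le_inf => //; exists t'.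
have ct' : inf B <= t' by apply: ge_inf => //; exists t.
set c := inf B in hB tc ct'.
have Fc : F c <= F t.
  have [<-//|tc'] := eqVneq t c.
  have {}tc' : t < c by rewrite lt_neqAle tc'.
  have /near0P[eta eta0 H] := Fl c ltac:(lra).
  pose h := Num.min eta (c - t) / 2.
  have h0 : 0 < Num.min eta (c - t) by rewrite lt_min eta0; lra.
  have [h1 h2] : Num.min eta (c - t) <= eta /\ Num.min eta (c - t) <= c - t.
    by rewrite !ge_min !lexx orbT.
  have hc : 0 < h < eta by rewrite /h; lra.
  apply: le_trans (H _ hc) _; rewrite leNgt; apply/negP => K.
  have : c <= c - h by apply: ge_inf; [exists t|split=> //; rewrite /h; lra].
  by rewrite /h; lra.
have /near0P[eta eta0 H] := Fr c ltac:(lra).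
have [v [tv Fv] vc] := inf_adherent eta0 hB.
have cv : c <= v by apply: ge_inf => //; exists t.
have [cv'|cv'] := eqVneq c v; first by move: Fv; rewrite -cv'; lra.
have {}cv' : c < v by rewrite lt_neqAle cv'.
have : F (c + (v - c)) <= F c by apply: H; rewrite -/c in vc; lra.
by rewrite addrC subrK; lra.
Qed.

End Local.

(** * Slopes of rational functions *)

Section RationalFunctions.
Set Implicit Arguments.
Unset Strict Implicit.
Variables (R : realType) (Gamma : metricType R).

Lemma slopeE (f : Gamma -> R) p (k : int) :
  (\forall h \near 0^'+, f (p h) = f (p 0) + k%:~R * h) -> slope f p = k.
Proof.
move=> H; apply: xget_subset1 => // k1 k2 /= H1 H2.
have /near0P[eta eta0 K] : \forall h \near (0 : R)^'+, (k1 = k2 :> int).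
  near=> h; apply/eqP; rewrite -(eqr_int R); apply/eqP.
  have h0 : h != 0 by rewrite gt_eqF.
  apply: (mulIf h0); apply: (addrI (f (p 0))).
  by rewrite -(near H1 h) // (near H2 h).
by apply: (K (eta / 2)); lra.
Unshelve. all: by end_near. Qed.

(** A rational function is affine on a germ, for any model. *)
Lemma rat_affine_germ (f : Gamma -> R) (M : model Gamma) (o : oedge M) t :
  is_rat f -> 0 <= t < olen o ->
  exists2 eta : R, 0 < eta & forall h, 0 <= h < eta -> t + h < olen o /\
    f (opt o (t + h)) = f (opt o t) + (slope f (edge_dir o t))%:~R * h.
Proof.
move=> [_ [M' af]] ht.
have [ [e b] [t' [ [ht' E] [eta eta0 H]]]] := germ_match M' ht.
have [k ke] := af e.
have [k' k'e] : exists k' : int, forall h, 0 <= h < eta ->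
    f (opt o (t + h)) = f (opt o t) + k'%:~R * h.
  exists (if b then k else - k) => h hh; have [h1 h2 ->] := H _ hh; rewrite -E.
  move: ht' h2 {E H h1}; rewrite /olen /opt; case: b => /= ht' h2.
    by rewrite (ke (t' + h)) ?(ke t'); lra.
  by rewrite rmorphN (ke (len e - (t' + h))) ?(ke (len e - t')); lra.
have sk : slope f (edge_dir o t) = k'.
  apply: slopeE; apply/near0P; exists eta => // h hh.
  by rewrite /edge_dir addr0 k'e //; lra.
exists eta => // h hh; split; first by have [] := H _ hh.
by rewrite sk k'e.
Qed.

(** Near a point, the forward slope along an edge is constant, and the
    backward slope is its opposite. *)
Lemma rat_slope_near (f : Gamma -> R) (M : model Gamma) (o : oedge M) t :
  is_rat f -> 0 <= t < olen o -> \forall h \near (0 : R)^'+,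
    slope f (edge_dir o (t + h)) = slope f (edge_dir o t) /\
    slope f (edge_dir (orev o) (olen o - (t + h))) = - slope f (edge_dir o t).
Proof.
move=> fr ht; have [eta eta0 H] := rat_affine_germ fr ht.
apply/near0P; exists eta => // h hh; have [th fh] := H h ltac:(lra).
split; apply: slopeE; apply/near0P.
  exists (eta - h); first by lra.
  move=> h' hh'; rewrite /edge_dir addr0 fh -addrA.
  by have [_ ->] := H (h + h') ltac:(lra); rewrite mulrDr addrA.
exists h; first by lra.
move=> h' hh'; rewrite /edge_dir addr0 !opt_orev subKr fh.
have -> : olen o - (olen o - (t + h) + h') = t + (h - h') by lra.
have [_ ->] := H (h - h') ltac:(lra).
by rewrite mulrBr rmorphN mulNr addrA.
Qed.
End RationalFunctions.

(** * Compatible functions along an edge of the model of a slope structure *)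

Section SlopeStructures.
Set Implicit Arguments.
Unset Strict Implicit.
Variables (R : realType) (Gamma : metricType R) (r : nat).
Variable S : slope_structure Gamma r.

Lemma ss_slope_le (o : oedge S) (i j : 'I_r.+1) : (i <= j)%N ->
  ss_slope o i <= ss_slope o j.
Proof.
rewrite leq_eqVlt => /orP[/eqP/val_inj -> //|/(ss_slope_lt o)]; exact: ltW.
Qed.

Lemma ss_slope_orev (o : oedge S) i :
  ss_slope (orev o) i = - ss_slope o (rev_ord i).
Proof.
have /eqP := ss_slope_rev o (rev_ord i).
by rewrite rev_ordK addrC addr_eq0 => /eqP.
Qed.

Lemma mem_tangents (M : model Gamma) (o : oedge M) x t :
  is_pos o x t -> o \in tangents M x.
Proof. by move=> xt; rewrite inE; apply/asboolP; exists t. Qed.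

Lemma tangent_dirE (M : model Gamma) x (nu : tangent M x) t :
  is_pos (val nu) x t -> tangent_dir nu = edge_dir (val nu) t.
Proof. by move=> xt; rewrite /tangent_dir (xget_is_pos xt). Qed.

Lemma bdryE (M : model Gamma) f x (nu : tangent M x) t :
  is_pos (val nu) x t -> bdry M f x nu = slope f (edge_dir (val nu) t).
Proof. by move=> xt; rewrite ffunE (tangent_dirE xt). Qed.

Lemma slope_eltE p (o : oedge S) s j : is_pos o (p 0) s ->
  (\forall h \near 0^'+, p h = opt o (s + h)) -> slope_elt S p j = ss_slope o j.
Proof.
move=> os pn; rewrite /slope_elt; case: pickP => [nu /asboolP[_ nun]|].
  have := valP nu; rewrite inE => /asboolP[s2 xs2].
  rewrite (tangent_dirE xs2) in nun; have /near0P[eta eta0 H] :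
    \forall h \near (0 : R)^'+, opt o (s + h) = opt (val nu) (s2 + h).
    by near=> h; rewrite -(near pn h) // (near nun h).
  congr (ss_slope _ j); apply/esym; apply: germ_oedge_inj H => //.
    by case: os.
  by case: xs2.
pose nu : tangent S (p 0) := Sub o (mem_tangents os).
move=> /(_ nu)/negP[]; apply/asboolP.
rewrite (@tangent_dirE _ _ nu s) //=; split=> //.
by rewrite /edge_dir addr0; case: (os).
Unshelve. all: by end_near. Qed.

(** Inside an edge the rank function is standard: the indices of the two
    outgoing slopes of a function whose rank is at least [n] have sum at most
    [r - n]. *)
Lemma interior_rank f (o : oedge S) t (n : nat) : 0 < t < olen o ->
  rank_bdry_ge S f (opt o t) n%:Z ->
  exists i i' : 'I_r.+1, [/\ (i + i' + n <= r)%N,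
    slope f (edge_dir o t) = ss_slope o i &
    slope f (edge_dir (orev o) (olen o - t)) = ss_slope (orev o) i'].
Proof.
move=> ht [a [fa na]]; set x := opt o t in a fa na.
have ot : is_pos o x t by split => //; lra.
have ot' : is_pos (orev o) x (olen o - t).
  by split; [rewrite /olen /= in ht *; lra|rewrite opt_orev subKr].
pose nu : tangent S x := Sub o (mem_tangents ot).
pose nu' : tangent S x := Sub (orev o) (mem_tangents ot').
have nn : nu' != nu by rewrite -val_eqE /= orev_neq.
exists (a nu), (a nu'); split.
- move: na; rewrite ss_rank_std; last by move=> v /esym; apply: opt_neq_vpt.
  rewrite /standard_rank le_max => /orP[|]; first by lia.
  rewrite (bigD1 nu) //= (bigD1 nu') //=.
  set s := \sum_(_ | _) _; have : 0 <= s by apply: sumr_ge0.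
  by lia.
- by move/ffunP/(_ nu): (fa); rewrite (bdryE f (nu := nu) ot) ffunE.
- by move/ffunP/(_ nu'): (fa); rewrite (bdryE f (nu := nu') ot') ffunE.
Qed.

Lemma compatible_rank_ge0 f x : compatible S f -> rank_bdry_ge S f x 0.
Proof. by move=> /(_ x)[_ [a [a0 _] E]]; exists a; split. Qed.

(** A compatible function is concave on every edge. *)
Lemma compatible_slope_nonincreasing f (o : oedge S) t t' :
  is_rat f -> compatible S f -> 0 <= t -> t < t' -> t' < olen o ->
  slope f (edge_dir o t') <= slope f (edge_dir o t).
Proof.
move=> fr fc t0 tt' t'o.
apply: (nonincreasing_of_local (F := fun t => slope f (edge_dir o t))
  _ _ t0 tt' t'o) => {t t' t0 tt' t'o} t ht.
  by apply: filterS (rat_slope_near fr ht) => h [-> _].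
have [i [i' [ii' Ei Ei']]] :=
  interior_rank (n := 0) ht (compatible_rank_ge0 _ fc).
have ht' : 0 <= olen o - t < olen (orev o) by rewrite /olen /= in ht *; lra.
apply: filterS (rat_slope_near fr ht') => h [_]; rewrite orevK.
have -> : olen (orev o) - (olen o - t + h) = t - h by rewrite /olen /=; lra.
move=> ->; rewrite Ei Ei' ss_slope_orev opprK; apply: ss_slope_le => /=; lia.
Qed.

(** If a compatible function has rank at least [j] at an interior point of the
    edge [o], then its slope at an earlier point of [o] is at least the [j]-th
    element. *)
Lemma compatible_slope_ge f (o : oedge S) s t (j : 'I_r.+1) :
  is_rat f -> compatible S f -> 0 <= s -> s < t -> t < olen o ->
  rank_bdry_ge S f (opt o t) (j : nat)%:Z ->
  ss_slope o j <= slope f (edge_dir o s).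
Proof.
move=> fr fc s0 st to fj.
have [|i [i' [ii' Ei Ei']]] := interior_rank _ fj; first by lra.
have ht' : 0 <= olen o - t < olen (orev o) by rewrite /olen /= in to *; lra.
have /near0P[eta eta0 H] := rat_slope_near fr ht'.
pose h := Num.min eta (t - s) / 2.
have h0 : 0 < Num.min eta (t - s) by rewrite lt_min eta0; lra.
have [h1 h2] : Num.min eta (t - s) <= eta /\ Num.min eta (t - s) <= t - s.
  by rewrite !ge_min !lexx orbT.
have [_] := H h ltac:(rewrite /h; lra); rewrite orevK.
have -> : olen (orev o) - (olen o - t + h) = t - h by rewrite /olen /=; lra.
rewrite Ei' ss_slope_orev opprK => E.
(* the slope just before [t] is the opposite of the backward slope at [t] *)
apply: (@le_trans _ _ (slope f (edge_dir o (t - h)))); last first.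
  by apply: compatible_slope_nonincreasing => //; rewrite /h; lra.
rewrite E; apply: ss_slope_le => /=; lia.
Qed.
End SlopeStructures.

(** * Crossing a point of valency two *)

Section Crossing.
Set Implicit Arguments.
Unset Strict Implicit.
Variables (R : realType) (Gamma : metricType R) (r : nat).
Variable S : slope_structure Gamma r.

(** The divisor [m (y) + n (z)]; the points [y] and [z] may coincide. *)
Lemma two_point_divisor (y z : Gamma) (m n : nat) : exists E : divisor Gamma,
  [/\ effective E, degree E = (m + n)%:Z, m%:Z <= E y & n%:Z <= E z].
Proof.
pose g (w : Gamma) : int :=
  (if w == y then m%:Z else 0) + (if w == z then n%:Z else 0).
have g0 w : 0 <= g w by rewrite /g; do 2!case: ifP.
pose E : divisor Gamma := [fsfun w in [fset y; z]%fset => g w].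
have Eg w : E w = g w.
  rewrite fsfunE !inE; case: ifP => // /norP[yw zw].
  by rewrite /g (negPf yw) (negPf zw).
exists E; split.
- by move=> w; rewrite Eg.
- have sub : (finsupp E `<=` [fset y; z])%fset by exact: finsupp_sub.
  rewrite /degree (big_fset_incl _ sub) /=; last first.
    by move=> w _; rewrite memNfinsupp => /eqP.
  under eq_bigr do rewrite Eg.
  have one (v : Gamma) (k : nat) : v \in [fset y; z]%fset ->
      \sum_(w <- [fset y; z]%fset) (if w == v then k%:Z else 0) = k%:Z.
    move=> vin; rewrite (big_fsetD1 v) //= eqxx big1_seq ?addr0 // => w.
    by rewrite !inE => /andP[_ /andP[/negPf ->]].
  by rewrite big_split /= !one ?PoszD // !inE eqxx ?orbT.
- by rewrite Eg /g eqxx lerDl; case: ifP.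
- by rewrite Eg /g eqxx lerDr; case: ifP.
Qed.

(** The existence of a crude linear series constrains the slopes along the two
    tangent vectors [o], [o'] at a point of valency two outside the support of
    [D]; [rev_ord j] is [r - j]. *)
Lemma crude_slope_sum_le0 (D : divisor Gamma) x (o o' : oedge S) s s'
    (j : 'I_r.+1) :
  crude_linear_series S D -> D x = 0 ->
  is_pos o x s -> is_pos o' x s' -> o != o' ->
  (forall o2, o2 \in tangents S x -> o2 = o \/ o2 = o') ->
  ss_slope o j + ss_slope o' (rev_ord j) <= 0.
Proof.
move=> DS Dx ox ox' oo ox2; have [hs _] := ox; have [hs' _] := ox'.
pose t := (s + olen o) / 2; pose t' := (s' + olen o') / 2.
have [E [E0 dE Ey Ez]] := two_point_divisor (opt o t) (opt o' t') j (rev_ord j).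
have [|f [ [fr fc fD] fE _]] := DS E E0.
  by rewrite dE /= subSS subnKC // -ltnS.
have rk y n : n <= E y -> rank_bdry_ge S f y n.
  move=> nE; have [a [fa aE]] := fE y; exists a; split=> //.
  exact: le_trans aE.
(* the positions [t] and [t'] are midway between [x] and the heads *)
have fj : ss_slope o j <= slope f (edge_dir o s).
  by apply: (compatible_slope_ge (t := t)) (rk _ _ Ey) => //; rewrite /t; lra.
have fj' : ss_slope o' (rev_ord j) <= slope f (edge_dir o' s').
  by apply: (compatible_slope_ge (t := t')) (rk _ _ Ez) => //; rewrite /t'; lra.
have := fD x; rewrite Dx add0r /ord oppr_ge0.
pose nu : tangent S x := Sub o (mem_tangents ox).
pose nu' : tangent S x := Sub o' (mem_tangents ox').
have nn : nu' != nu by rewrite -val_eqE /= eq_sym.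
rewrite (bigD1 nu) //= (bigD1 nu') //= big1 ?addr0; last first.
  move=> mu /andP[mn mn']; have := ox2 _ (valP mu); case=> E1.
    by rewrite -val_eqE /= E1 eqxx in mn.
  by rewrite -val_eqE /= E1 eqxx in mn'.
by rewrite (bdryE f (nu := nu) ox) (bdryE f (nu := nu') ox'); lra.
Qed.

Variables (G : model Gamma) (e : oedge G).

(** Near the position [t] of [e], all slope sets, forward and backward, are read
    off the oriented edge [o] that carries the germ of [e] at [t]. *)
Lemma slope_elt_germ t : 0 <= t < olen e ->
  exists (o : oedge S) (s : R), is_pos o (opt e t) s /\
  \forall h \near (0 : R)^'+, [/\ opt e (t + h) = opt o (s + h),
    (forall j, slope_elt S (edge_dir e t) j = ss_slope o j),
    (forall j, slope_elt S (edge_dir e (t + h)) j = ss_slope o j) &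
    (forall j, slope_elt S (edge_dir (orev e) (olen e - (t + h))) j =
       ss_slope (orev o) j)].
Proof.
move=> ht; have [ o [s [os [eta eta0 H]]]] := germ_match S ht.
have [hs _] := os.
exists o, s; split=> //; apply/near0P; exists eta => // h hh.
have [th sh E] := H h ltac:(lra).
split=> // j.
- apply: (slope_eltE (s := s)); first by rewrite /edge_dir addr0.
  by apply/near0P; exists eta => // h' hh'; have [_ _ <-] := H h' ltac:(lra).
- apply: (slope_eltE (s := s + h)).
    by rewrite /edge_dir addr0; split; [lra|rewrite E].
  apply/near0P; exists (eta - h) => [|h' hh']; first by lra.
  by rewrite /edge_dir -!addrA; have [_ _ ->] := H (h + h') ltac:(lra).
- apply: (slope_eltE (s := olen o - (s + h))).
    rewrite /edge_dir addr0 opt_orev subKr E.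
    split; last by rewrite opt_orev subKr.
    by rewrite /olen /= in sh hs *; lra.
  apply/near0P; exists h => [|h' hh']; first by lra.
  rewrite /edge_dir !opt_orev.
  have -> : olen e - (olen e - (t + h) + h') = t + (h - h') by lra.
  have -> : olen o - (olen o - (s + h) + h') = s + (h - h') by lra.
  by have [_ _ ->] := H (h - h') ltac:(lra).
Qed.
End Crossing.

Theorem proposition4p3 (R : realType) (Gamma : metricType R)
    (Gamma_graph : metric_graph Gamma) (r : nat) (D : divisor Gamma)
    (S : slope_structure Gamma r) (DS : crude_linear_series S D)
    (G : model Gamma) (DG : supported_on_vertices D G) (e : oedge G) :
  (forall t : R, 0 <= t < olen e ->
     \forall eps \near 0^'+, forall j : 'I_r.+1,
       slope_elt S (edge_dir e (t + eps)) j <= slope_elt S (edge_dir e t) j) /\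
  (forall t t' : R, 0 <= t -> t < t' -> t' < olen e -> forall j : 'I_r.+1,
     slope_elt S (edge_dir e t') j <= slope_elt S (edge_dir e t) j).
Proof.
have near_right t : 0 <= t < olen e -> \forall h \near 0^'+, forall j : 'I_r.+1,
    slope_elt S (edge_dir e (t + h)) j <= slope_elt S (edge_dir e t) j.
  move=> ht; have [ o [s [_ H]]] := slope_elt_germ S ht.
  by apply: filterS H => h [_ E Eh _] j; rewrite E Eh.
split=> // t t' t0 tt' t'e j; move: t0 tt' t'e.
apply: (nonincreasing_of_local (F := fun t => slope_elt S (edge_dir e t) j))
  => {t t'} t ht.
  by apply: filterS (near_right t ht).
(* it remains to cross the point [opt e t], which is interior to [e] *)
have he : 0 <= t < olen e by lra.
have he' : 0 <= olen e - t < olen (orev e) by rewrite /olen /= in ht *; lra.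
have [ o [s [os H]]] := slope_elt_germ S he.
have [ o' [s' [os' H']]] := slope_elt_germ S he'.
set x := opt e t in os; rewrite opt_orev subKr -/x in os'.
have Dx : D x = 0.
  apply/eqP; apply: contraT => /DG[v vx]; have := @opt_neq_vpt _ _ _ e t v ht.
  by rewrite vx.
have oo : o != o'.
  apply/negP => /eqP E; subst o'; rewrite (is_pos_uniq os' os) in H'.
  have /near0P[eta eta0 K] : \forall h \near (0 : R)^'+,
      opt e (t + h) = opt (orev e) (olen e - t + h).
    by apply: filterS2 H H' => h [-> _ _ _] [-> _ _ _].
  have := germ_oedge_inj eta0 he he' K.
  by move/eqP; rewrite eq_sym (negPf (orev_neq e)).
(* a tangent vector at [x] in the model of [S] has the germ of a tangent vector
   along [e], and the point is interior to [e] *)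
have two o2 : o2 \in tangents S x -> o2 = o \/ o2 = o'.
  rewrite inE => /asboolP[s2 xs2]; have [hs2 E2] := xs2.
  have [e2 [t2 [ [ht2 E2t] [eta eta0 K]]]] := germ_match G hs2.
  rewrite E2 in E2t.
  have K' : \forall h \near (0 : R)^'+, opt o2 (s2 + h) = opt e2 (t2 + h).
    by apply/near0P; exists eta => // h hh; have [_ _ ->] := K h ltac:(lra).
  have [|[ee tt]|[ee tt]] := opt_inj_int ht _ (esym E2t); first by lra.
  - left; rewrite -ee -tt in K'; have /near0P[nu nu0 N] :
        \forall h \near (0 : R)^'+, opt o2 (s2 + h) = opt o (s + h).
      by apply: filterS2 H K' => h [<- _ _ _].
    by apply: (germ_oedge_inj nu0 _ _ N) => //; case: os.
  - right; rewrite ee tt in K'; have /near0P[nu nu0 N] :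
        \forall h \near (0 : R)^'+, opt o2 (s2 + h) = opt o' (s' + h).
      by apply: filterS2 H' K' => h [<- _ _ _].
    by apply: (germ_oedge_inj nu0 _ _ N) => //; case: os'.
have K := crude_slope_sum_le0 j DS Dx os os' oo two.
have /near0P[eta eta0 Ht] := H.
have [_ Et _ _] := Ht (eta / 2) ltac:(lra).
apply: filterS H' => h [_ _ _]; rewrite orevK.
have -> : olen (orev e) - (olen e - t + h) = t - h by rewrite /olen /=; lra.
by move=> ->; rewrite Et ss_slope_orev; lra.
Qed.
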